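(* For each $n\in\mathbb{N}$ let $G_n=(V_n,E_n,w_n)$ be a finite undirected $d_n$-regular tree with hierarchical edge weights, and let $x_n,y_n\in V_n$ be vertices such that $x_n$ is the parent of $y_n$ and such that the minimal distance between $y_n$ and a leaf of $G_n$ is constant in $n$; denote this constant by $k$. Let $e_n$ be the edge between $x_n$ and $y_n$ and let $q_n>0$ be the intensity parameter. Then as $n\to\infty$, $$U_{q_n}^{(G_n)}(x_n,y_n)\to\begin{cases}0&\text{if }q_n=o\left(d_n^{-k}w_n(e_n)\right)\\1&\text{if }q_n=\omega\left(d_n^{-k}w_n(e_n)\right).\end{cases}$$
   Context: Trees here have one vertex specified as the ancestor. The height (generation) of a vertex is its graph distance to the ancestor, and an edge between heights $i-1$ and $i$ belongs to generation $i$. The height of the tree is the maximal height of its vertices. If $u$ at height $h$ and $v$ at height $h-1$ are adjacent, $u$ is a child of $v$ and $v$ is the parent of $u$. The tree is $d$-regular if every vertex with height less than the height of the tree has exactly $d$ children; leaves are the vertices without children. Edge weights $w:E\to[0,\infty)$ are hierarchical if (i) edges in the same generation have equal weight, and (ii) if $e_i,e_j$ are edges in generations $i<j$, then $w(e_i)\le w(e_j)$. An undirected weighted graph is considered as a directed graph in which each undirected edge gives two directed edges (one per orientation) of the same weight. A rooted spanning forest of a finite directed graph $G$ is a subset $F$ of its directed edges such that each vertex has at most one outgoing edge in $F$ and $F$ contains no directed cycle; its roots are the vertices without outgoing edge in $F$ and $r(F)$ is the number of roots. For $q>0$, the random rooted spanning forest $\Phi_q$ of $G$ has law $\mathbb{P}(\Phi_q=F)=q^{r(F)}w(F)/Z_G(q)$,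 where $w(F)=\prod_{e\in F}w(e)$ and $Z_G(q)=\sum_Fq^{r(F)}w(F)$. $U_q^{(G)}(x,y)$ is the probability that $x$ and $y$ belong to different trees (connected components, ignoring orientation) of $\Phi_q$. Notation: $a_n=\omega(b_n)$ means $b_n=o(a_n)$. *)

(* Defs.v *)
From HB Require Import structures.
From mathcomp Require Import all_boot all_order all_algebra.
From mathcomp Require Import all_classical all_reals all_analysis.

Set Implicit Arguments.
Unset Strict Implicit.
Unset Printing Implicit Defensive.

Import Order.TTheory GRing.Theory Num.Theory.
Import numFieldNormedType.Exports.

Local Open Scope ring_scope.

(* The value of [weight] on pairs that are not arcs is irrelevant. *)
Record wdigraph (R : realType) := WDigraph {
  vertex :> finType;
  arc : rel vertex;
  weight : vertex -> vertex -> R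
}.

Definition root_of (V : finType) (F : {set V * V}) (x : V) : bool :=
  [forall y, (x, y) \notin F].

Definition nroots (V : finType) (F : {set V * V}) : nat :=
  #|[set x | root_of F x]|.

Definition rooted_forest (R : realType) (G : wdigraph R)
    (F : {set G * G}) : Prop :=
  [/\ (forall x y : G, (x, y) \in F -> arc x y),
      (forall x y z : G, (x, y) \in F -> (x, z) \in F -> y = z) &
      (forall c : seq G, c != [::] -> ~~ cycle (fun x y => (x, y) \in F) c)].

Definition same_tree (V : finType) (F : {set V * V}) (x y : V) : bool :=
  connect (fun u v => ((u, v) \in F) || ((v, u) \in F)) x y.

Definition forest_weight (R : realType) (G : wdigraph R) (q : R)
    (F : {set G * G}) : R :=
  q ^+ nroots F * \prod_(e in F) weight e.1 e.2.

Definition partition_function (R : realType) (G : wdigraph R) (q : R) : R :=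
  \sum_(F : {set G * G} | `[< rooted_forest F >]) forest_weight q F.

Definition forest_law (R : realType) (G : wdigraph R) (q : R)
    (F : {set G * G}) : R :=
  forest_weight q F / partition_function G q.

Definition U (R : realType) (G : wdigraph R) (q : R) (x y : G) : R :=
  \sum_(F : {set G * G} | `[< rooted_forest F >] && ~~ same_tree F x y)
    forest_law q F.

(* An undirected graph is a digraph whose arc relation and weights are
   symmetric: each undirected edge is a pair of opposite arcs. *)
Record wtree (R : realType) := WTree {
  tree_digraph :> wdigraph R;
  ancestor : tree_digraph;
  arc_sym : symmetric (@arc R tree_digraph);
  arc_irrefl : irreflexive (@arc R tree_digraph);
  tree_connected : forall x y : tree_digraph, connect (@arc R tree_digraph) x y;
  tree_acyclic : forall c : seq tree_digraph,
    (2 < size c)%N -> uniq c -> ~~ cycle (@arc R tree_digraph) c;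
  weight_sym : forall x y : tree_digraph, arc x y -> weight x y = weight y x;
  weight_ge0 : forall x y : tree_digraph, arc x y -> 0 <= weight x y
}.

(* Least length of a path from [x] to [y]; the default value [#|G|] is only
   taken when [x] and [y] are not connected. *)
Definition graph_dist (R : realType) (G : wdigraph R) (x y : G) : nat :=
  \big[minn/#|G|]_(n < #|G| |
     [exists p : n.-tuple G, path (@arc R G) x p && (last x p == y)]) n.

Definition height (R : realType) (T : wtree R) (x : T) : nat :=
  graph_dist x (ancestor T).

Definition tree_height (R : realType) (T : wtree R) : nat :=
  \max_(x : T) height x.

Definition is_parent (R : realType) (T : wtree R) (v u : T) : bool :=
  arc v u && (height u == (height v).+1).

Definition children (R : realType) (T : wtree R) (v : T) : {set T} :=
  [set u | is_parent v u].

Definition is_leaf (R : realType) (T : wtree R) (v : T) : bool :=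
  children v == finset.set0.

Definition regular (R : realType) (T : wtree R) (d : nat) : Prop :=
  forall v : T, (height v < tree_height T)%N -> #|children v| = d.

Definition in_generation (R : realType) (T : wtree R) (i : nat) (u v : T) :
    bool :=
  is_parent u v && (height v == i) || is_parent v u && (height u == i).

Definition hierarchical (R : realType) (T : wtree R) : Prop :=
  (forall (i : nat) (u v u' v' : T),
     in_generation i u v -> in_generation i u' v' ->
     weight u v = weight u' v') /\
  (forall (i j : nat) (u v u' v' : T), (i < j)%N ->
     in_generation i u v -> in_generation j u' v' ->
     weight u v <= weight u' v').

(* A finite tree has a leaf, and distances are smaller than [#|T|], so that the
   default value is not reached. *)
Definition leaf_dist (R : realType) (T : wtree R) (y : T) : nat :=
  \big[minn/#|T|]_(v : T | is_leaf v) graph_dist y v.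

(* Main.v *)
Require Import Defs.
From mathcomp Require Import all_boot all_order all_algebra.
From mathcomp Require Import all_classical all_reals all_analysis.
From mathcomp Require Import ring lra.

Set Implicit Arguments.
Unset Strict Implicit.
Unset Printing Implicit Defensive.

Import Order.TTheory GRing.Theory Num.Theory.
Import numFieldNormedType.Exports.

Local Open Scope classical_set_scope.
Local Open Scope ring_scope.

(** Let [e] be the edge between the adjacent vertices [x] and [y] of a weighted
    tree, and [w] its weight. A rooted forest joins [x] and [y] exactly when it
    uses [e] in one of its two orientations. Deleting [e] from such a forest
    turns the tail of [e] into a root, which trades a factor [w] for a factor
    [q]. If [P] is the law of the random forest of the tree without [e], then

      1 / U q x y = 1 + w P(x is a root) / q + w P(y is a root) / q.

    The number q / P(v is a root) is the effective conductance between [v] and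
    a cemetery which is joined to every vertex by an edge of weight [q]. So
    everything reduces to estimating, for each end of [e], the conductance of
    the branch that hangs from it once [e] is cut ([U_edge]).

    Adding an edge of weight [w] between two components adds to the conductance
    of one end the series composition of [w] with the conductance of the other
    end ([conductance_add_edge]). Attaching the branches at [v] one by one gives
    a recursion along the tree ([branch_cond_rec]): the conductance C(v -> p) of
    the branch at [v] away from its neighbour [p] satisfies

      C(v -> p) = q + sum over the neighbours u <> p of v of
                      w(u,v) C(u -> v) / (C(u -> v) + w(u,v)).

    In a [d]-regular tree, a vertex at distance [j] from the leaves has [d]
    children if [j > 0] and none if [j = 0]. A series composition is at most
    each of its two terms, so C(y -> x) <= (k+1) d^k q ([branch_cond_le]). It
    is at least half the smaller term, and the weights in the branch at [y] are at
    least [w], so C(y -> x) >= 2^-k min (d w, d^k q) ([branch_cond_ge_min]).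
    The siblings of [y] give the same lower bound for C(x -> y) up to a factor 4
    ([parent_conductance_ge]).

    In the first regime [w] is positive, and the upper bound gives
    U <= C(y -> x) / w <= (k+1) d^k q / w, which tends to 0. In the second
    regime w / (d^k q) tends to 0, and [w] is much smaller than both
    conductances: either [d] is large, and the lower bound applies, or [d] is
    bounded, and then w / q is small, while a conductance is never smaller than
    [q]. Hence 1 - U, which is at most w / C(x -> y) + w / C(y -> x), tends
    to 0. *)

(** * Conductances in series *)

Section Series.

Variable R : realFieldType.
Implicit Types t w c : R.

Definition in_series w c : R := w * c / (c + w).

Lemma in_series_ge0 w c : 0 <= w -> 0 < c -> 0 <= in_series w c.
Proof. by move=> w0 c0; rewrite divr_ge0 ?mulr_ge0 ?addr_ge0 // ltW. Qed.

Lemma in_series_le w c : 0 <= w -> 0 < c -> in_series w c <= c.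
Proof.
move=> w0 c0; rewrite /in_series ler_pdivrMr ?ltr_pwDl // mulrDr [c * w]mulrC.
by rewrite lerDr mulr_ge0 // ltW.
Qed.

(** Putting two conductances in series costs at most a factor 2 compared to
    the smaller one. *)
Lemma in_series_ge t w c : t <= w -> t <= c -> 0 <= w -> 0 < c ->
  t / 2 <= in_series w c.
Proof.
by move=> tw tc w0 c0; rewrite /in_series ler_pdivlMr ?ltr_pwDl //; nra.
Qed.

End Series.

(** * Forests as out-maps *)

Section OutMaps.

Variables (R : realType) (V : finType) (w : V -> V -> R) (q : R).

Notation outmap := {ffun V -> option V}.
Implicit Types (S : rel V) (A : pred V) (f g : outmap) (P Q : pred outmap).

(** [f u] is the head of the arc leaving [u], or [None] at a root. In a tree
    every directed cycle contains two opposite arcs, so forbidding such pairs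
    is enough; the point is that this condition, unlike acyclicity, involves
    only two values of [f]. *)
Definition admissible S f : bool :=
  [forall u, forall v, (f u == Some v) ==> S u v && (f v != Some u)].

Definition outmap_weight f : R :=
  \prod_u (if f u is Some v then w u v else q).

Definition forest_sum S P : R :=
  \sum_(f | admissible S f && P f) outmap_weight f.

Definition rooted_at (v : V) : pred outmap := fun f => f v == None.

(** The effective conductance, in the graph [S], between [v] and a cemetery
    joined to every vertex by an edge of weight [q]: this is [q] divided by the
    probability that [v] is a root. *)
Definition conductance S v : R :=
  q * forest_sum S predT / forest_sum S (rooted_at v).

Lemma admissibleP S f :
  reflect (forall u v, f u = Some v -> S u v /\ f v <> Some u)
          (admissible S f).
Proof.
apply: (iffP forallP) => [Sf u v fu|Sf u].
  by have /forallP/(_ v) := Sf u; rewrite fu eqxx => /andP[-> /eqP].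
by apply/forallP => v; apply/implyP => /eqP /Sf[-> /eqP].
Qed.

Lemma eq_forest_sum S P Q :
  (forall f, admissible S f -> P f = Q f) -> forest_sum S P = forest_sum S Q.
Proof.
by move=> PQ; apply: eq_bigl => f; case: (boolP (admissible S f)) => //= /PQ.
Qed.

Lemma forest_sum_split S P Q :
  forest_sum S P = forest_sum S (predI P Q) + forest_sum S (predD P Q).
Proof.
rewrite /forest_sum (bigID Q) /=; congr (_ + _); apply: eq_bigl => f /=.
  by rewrite andbA.
by rewrite -andbA (andbC (P f)).
Qed.

Definition splice A f g : outmap := [ffun v => if A v then f v else g v].

(** No edge of [S] or [S'] crosses the boundary of [A]. *)
Definition same_inside A S S' : Prop :=
  [/\ forall u v, S u v -> A u = A v, forall u v, S' u v -> A u = A v &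
      forall u v, A u -> A v -> S u v = S' u v].

Lemma same_inside_sym A S S' : same_inside A S S' -> same_inside A S' S.
Proof. by case=> SA S'A SS'; split=> // u v Au Av; rewrite SS'. Qed.

Lemma splice_admissible A S S' f g : same_inside A S S' ->
  admissible S f -> admissible S' g ->
  admissible S' (splice A f g) /\ admissible S (splice A g f).
Proof.
move=> [SA S'A SS'] /admissibleP Sf /admissibleP S'g; split.
  apply/admissibleP => u v; rewrite !ffunE; case: ifPn => Au.
    by move=> /Sf[Suv fv]; rewrite -(SA _ _ Suv) Au -SS' // -?(SA _ _ Suv).
  by move=> /S'g[Suv gv]; rewrite -(S'A _ _ Suv) (negbTE Au).
apply/admissibleP => u v; rewrite !ffunE; case: ifPn => Au.
  by move=> /S'g[Suv gv]; rewrite -(S'A _ _ Suv) Au SS' // -?(S'A _ _ Suv).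
by move=> /Sf[Suv fv]; rewrite -(SA _ _ Suv) (negbTE Au).
Qed.

Lemma splice_weight A f g :
  outmap_weight (splice A f g) * outmap_weight (splice A g f) =
  outmap_weight f * outmap_weight g.
Proof.
rewrite -!big_split; apply: eq_bigr => v _ /=; rewrite !ffunE.
by case: (A v) => //=; rewrite mulrC.
Qed.

Lemma spliceK A f g : splice A (splice A f g) (splice A g f) = f.
Proof. by apply/ffunP => v; rewrite !ffunE; case: (A v). Qed.

(** Swapping the parts outside [A] of a forest of [S] and of a forest of [S'] is
    an involution which preserves the product of the weights. It expresses both
    the independence of what happens inside and outside [A] (for [S = S']) and
    the fact that what happens inside [A] does not depend on the edges outside
    (for trivial [Q]). *)
Lemma forest_sum_exchange A S S' P Q : same_inside A S S' ->
  (forall f g, P (splice A f g) = P f) ->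
  (forall f g, Q (splice A g f) = Q f) ->
  forest_sum S (predI P Q) * forest_sum S' predT =
  forest_sum S' P * forest_sum S Q.
Proof.
move=> SS' PA QA; rewrite /forest_sum !big_distrlr !pair_big /=.
pose h (fg : outmap * outmap) := (splice A fg.1 fg.2, splice A fg.2 fg.1).
have hK : involutive h by case=> f g; rewrite /h /= !spliceK.
rewrite [RHS](reindex_inj (inv_inj hK)) /=.
apply: eq_big => [[f g]|[f g] _] /=; last by rewrite splice_weight.
rewrite PA QA andbT; apply/idP/idP.
  case/andP=> /and3P[Sf -> ->] S'g; rewrite !andbT.
  by have [-> ->] := splice_admissible SS' Sf S'g.
case/andP=> /andP[S'f ->] /andP[Sg ->]; rewrite !andbT.
have [] := splice_admissible (same_inside_sym SS') S'f Sg.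
by rewrite !spliceK => -> ->.
Qed.

Definition without (S : rel V) (u v : V) : rel V :=
  fun a b => [&& S a b, (a, b) != (u, v) & (a, b) != (v, u)].

Lemma withoutC S u v : without S u v = without S v u.
Proof.
by apply/funext => a; apply/funext => b; rewrite /without [X in _ && X]andbC.
Qed.

Definition redirect v o f : outmap := [ffun z => if z == v then o else f z].

(** Forests using the arc from [v] to [u] correspond, by deleting this arc, to
    the forests of the graph without the edge in which [v] is a root: the
    admissibility condition leaves nothing else to check when putting the arc
    back. *)
Lemma forest_sum_edge S u v P : q != 0 -> S v u -> u != v ->
  (forall f o, P (redirect v o f) = P f) ->
  forest_sum S (predI P (fun f => f v == Some u)) =
  w v u / q * forest_sum (without S u v) (predI P (rooted_at v)).
Proof.
move=> q0 Svu uv Pv; rewrite /forest_sum.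
rewrite (reindex_onto (redirect v (Some u)) (redirect v None)) /=; last first.
  move=> f /and3P[_ _ /eqP fv]; apply/ffunP => z; rewrite !ffunE.
  by case: eqP => // ->.
rewrite big_distrr; apply: eq_big => [f|f].
  rewrite Pv /rooted_at ffunE !eqxx andbT.
  have -> : (redirect v None (redirect v (Some u) f) == f) = (f v == None).
    apply/eqP/eqP => [<-|fv]; first by rewrite ffunE eqxx.
    by apply/ffunP => z; rewrite !ffunE; case: eqP => // ->.
  rewrite -andbA; case: (boolP (P f)) => _; rewrite ?andbF //=.
  case: (f v =P None) => fv; rewrite ?andbF //= !andbT.
  apply/admissibleP/admissibleP => Sf a b.
    move=> fa; have av : a != v by apply/eqP => av; rewrite -av fa in fv.
    have := Sf a b; rewrite !ffunE (negbTE av) => /(_ fa)[Sab].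
    rewrite /without Sab !xpair_eqE (negbTE av) /= andbT.
    case: eqP => [->|bv].
      by case: (a =P u) => [->//|_] _; rewrite fv.
    by move=> fb; rewrite andbF.
  rewrite !ffunE; case: (a =P v) => [->|av].
    case=> <-; rewrite (negbTE uv); split=> // fu.
    by have [] := Sf _ _ fu; rewrite /without eqxx andbF.
  move=> fa; have [/and3P[Sab /eqP e1 /eqP e2] fb] := Sf _ _ fa.
  split=> //; case: eqP => // bv [ua]; apply: e1.
  by rewrite ua bv.
move=> /andP[_ /eqP fE].
have fv : f v = None by rewrite -fE ffunE eqxx.
rewrite /outmap_weight (bigD1 v) //= [in RHS](bigD1 v) //= ffunE eqxx fv.
rewrite !mulrA divfK //; congr (_ * _); apply: eq_bigr => z zv.
by rewrite ffunE (negbTE zv).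
Qed.

Section Positivity.

Variable S : rel V.
Hypotheses (q_gt0 : 0 < q) (w_ge0 : forall u v, S u v -> 0 <= w u v).

Lemma outmap_weight_ge0 f : admissible S f -> 0 <= outmap_weight f.
Proof.
move=> /admissibleP Sf; apply: prodr_ge0 => u _.
by case fu: (f u) => [v|]; [apply: w_ge0; case: (Sf _ _ fu) | exact: ltW].
Qed.

Lemma forest_sum_ge0 P : 0 <= forest_sum S P.
Proof. by apply: sumr_ge0 => f /andP[Sf _]; exact: outmap_weight_ge0. Qed.

Lemma forest_sum_gt0 P : P [ffun=> None] -> 0 < forest_sum S P.
Proof.
move=> P0; rewrite /forest_sum (bigD1 [ffun=> None]) /=; last first.
  by rewrite P0 andbT; apply/admissibleP => u v; rewrite ffunE.
apply: ltr_pwDl; last first.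
  by apply: sumr_ge0 => f /andP[/andP[Sf _] _]; exact: outmap_weight_ge0.
by apply: prodr_gt0 => u _; rewrite ffunE.
Qed.

Lemma forest_sum_rooted_gt0 v : 0 < forest_sum S (rooted_at v).
Proof. by apply: forest_sum_gt0; rewrite /rooted_at ffunE. Qed.

(** The probability of being a root is at most one. *)
Lemma conductance_ge v : q <= conductance S v.
Proof.
rewrite /conductance ler_pdivlMr ?forest_sum_rooted_gt0 // ler_pM2l //.
rewrite (forest_sum_split _ predT (rooted_at v)) lerDl; exact: forest_sum_ge0.
Qed.

Lemma conductance_isolated v :
  (forall u, ~~ S v u) -> conductance S v = q.
Proof.
move=> Sv; rewrite /conductance.
rewrite (@eq_forest_sum S predT (rooted_at v)).
  by rewrite mulfK // gt_eqF // forest_sum_rooted_gt0.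
move=> f /admissibleP Sf; rewrite /rooted_at; case fv: (f v) => [u|] //.
by have [Svu _] := Sf _ _ fv; have := Sv u; rewrite Svu.
Qed.

End Positivity.

(** Only the component of [v] matters for its conductance. *)
Lemma conductance_local A S S' v : 0 < q ->
  (forall a b, S a b -> 0 <= w a b) -> (forall a b, S' a b -> 0 <= w a b) ->
  same_inside A S S' -> A v -> conductance S v = conductance S' v.
Proof.
move=> q0 w0 w0' SS' Av.
have := @forest_sum_exchange A S S' (rooted_at v) predT SS'.
have -> : forest_sum S (predI (rooted_at v) predT) = forest_sum S (rooted_at v).
  by apply: eq_forest_sum => f _ /=; rewrite andbT.
move=> E; rewrite /conductance.
have {}E : forest_sum S (rooted_at v) * forest_sum S' predT =
           forest_sum S' (rooted_at v) * forest_sum S predT.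
  by apply: E => // f g; rewrite /rooted_at ffunE Av.
have Z0 : forest_sum S (rooted_at v) != 0.
  by rewrite gt_eqF ?forest_sum_rooted_gt0.
have Z0' : forest_sum S' (rooted_at v) != 0.
  by rewrite gt_eqF ?forest_sum_rooted_gt0.
apply/eqP; rewrite eqr_div //; apply/eqP.
by rewrite -!mulrA; congr (_ * _); rewrite mulrC -E mulrC.
Qed.

Section AddEdge.

Variables (S : rel V) (u v : V) (A : pred V).
Hypotheses (q_gt0 : 0 < q) (w_ge0 : forall a b, S a b -> 0 <= w a b).
Hypotheses (Suv : S u v) (Svu : S v u) (neq_uv : u != v).
Hypothesis w_sym : w u v = w v u.

Let S' := without S u v.

Lemma forest_sum_without P :
  forest_sum S' P =
  forest_sum S (predD (predD P (fun f => f u == Some v))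
                      (fun f => f v == Some u)).
Proof.
apply: eq_bigl => f /=.
case: (P f); rewrite ?andbF //= !andbT.
apply/idP/idP.
  move=> /admissibleP Sf.
  apply/and3P; split; first apply/admissibleP => a b /Sf.
  - by case=> /and3P[].
  - by apply/eqP => /Sf[]; rewrite /S' /without eqxx !andbF.
  - by apply/eqP => /Sf[]; rewrite /S' /without eqxx !andbF.
case/and3P=> /admissibleP Sf /eqP fv /eqP fu; apply/admissibleP => a b fa.
have [Sab fb] := Sf _ _ fa; split=> //; rewrite /S' /without Sab /=.
by apply/andP; split; apply/eqP => -[ea eb]; rewrite ea eb in fa.
Qed.

Lemma forest_sum_add_edge :
  forest_sum S predT =
  forest_sum S' predT +
  w u v / q * (forest_sum S' (rooted_at u) + forest_sum S' (rooted_at v)).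
Proof.
have q0 : q != 0 by rewrite gt_eqF.
rewrite (forest_sum_split _ _ (fun f => f u == Some v)).
rewrite (forest_sum_split S (predD _ _) (fun f => f v == Some u)).
rewrite -forest_sum_without.
rewrite (forest_sum_edge (u := v) (v := u) (P := predT)) ?[v == u]eq_sym //.
have -> : forest_sum S (predI (predD predT (fun f => f u == Some v))
                     (fun f => f v == Some u)) =
          forest_sum S (predI predT (fun f => f v == Some u)).
  apply: eq_forest_sum => f /admissibleP Sf /=.
  case: (f v =P Some u) => [fv|_]; rewrite ?andbF //=.
  by have [_ /eqP/negbTE->] := Sf _ _ fv; rewrite ?andbF.
rewrite (forest_sum_edge (u := u) (v := v) (P := predT)) // -w_sym withoutC.
rewrite -/S' [RHS]addrC mulrDr addrA; congr (_ + _ + _).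
Qed.

Lemma forest_sum_rooted_add_edge :
  forest_sum S (rooted_at u) =
  forest_sum S' (rooted_at u) +
  w u v / q * forest_sum S' (predI (rooted_at u) (rooted_at v)).
Proof.
have q0 : q != 0 by rewrite gt_eqF.
rewrite (forest_sum_split _ _ (fun f => f v == Some u)) w_sym.
rewrite -forest_sum_edge //; last first.
  by move=> f o; rewrite /rooted_at ffunE (negbTE neq_uv).
rewrite forest_sum_without addrC; congr (_ + _).
apply: eq_forest_sum => f Sf /=.
by rewrite /rooted_at; case: (f u) => [a|]; rewrite ?andbF ?andbT.
Qed.

Hypotheses (A_closed : forall a b, S' a b -> A a = A b).
Hypotheses (Au : A u) (Av : ~~ A v).

(** As [A] separates [u] from [v] in [S'], the events that [u] and that [v] are
    roots are independent for the forests of [S']. This expresses the three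
    conductances through the total weight of the forests of [S'] and the
    weights of those rooted at [u] and at [v]. *)
Lemma conductance_add_edge :
  conductance S u = conductance S' u + in_series (w u v) (conductance S' v).
Proof.
have w0' a b : S' a b -> 0 <= w a b by case/and3P=> /w_ge0.
have q0 : q != 0 by rewrite gt_eqF.
have Z0 : 0 < forest_sum S' predT by exact: forest_sum_gt0.
have Zu : 0 < forest_sum S' (rooted_at u) by exact: forest_sum_rooted_gt0.
have Zv : 0 < forest_sum S' (rooted_at v) by exact: forest_sum_rooted_gt0.
have wuv : 0 <= w u v by exact: w_ge0.
have E : forest_sum S' (predI (rooted_at u) (rooted_at v)) =
         forest_sum S' (rooted_at u) * forest_sum S' (rooted_at v) /
         forest_sum S' predT.
  have SS' : same_inside A S' S' by split.
  apply: canRL (mulfK _) _; first by rewrite gt_eqF.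
  apply: (forest_sum_exchange SS') => f g; first by rewrite /rooted_at ffunE Au.
  by rewrite /rooted_at ffunE; case: ifP Av => // ->.
rewrite /in_series /conductance forest_sum_add_edge.
rewrite forest_sum_rooted_add_edge E.
move: (forest_sum S' predT) (forest_sum S' (rooted_at u)) Z0 Zu => z a z0 a0.
move: (forest_sum S' (rooted_at v)) (w u v) Zv wuv => b c b0 c0.
have D1 : 0 < q * z + c * b by rewrite ltr_pwDl ?mulr_gt0 // mulr_ge0 // ltW.
have D2 : 0 < a * (q * z) + c * (a * b).
  by rewrite ltr_pwDl ?mulr_gt0 // mulr_ge0 // ltW // mulr_gt0.
by field; rewrite !gt_eqF.
Qed.

End AddEdge.

End OutMaps.

(** * Branches of a tree *)

Section TreeRecursion.

Variables (R : realType) (T : wtree R).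
Implicit Types (u v x y z : T).
Local Notation arc := Defs.arc.

Lemma arc_neq u v : arc u v -> u != v.
Proof. by case: eqP => // -> ; rewrite arc_irrefl. Qed.

Definition avoid v : rel T := fun a b => [&& arc a b, a != v & b != v].

(** For neighbours [u] and [v], the component of [u] after the edge between them
    is cut. Deleting the whole vertex [v] gives the same set, and makes it
    immediate that a branch does not contain [v]. *)
Definition branch u v : pred T := connect (avoid v) u.

Lemma avoid_sym v : symmetric (avoid v).
Proof. by move=> a b; rewrite /avoid arc_sym [X in _ && X]andbC. Qed.

Lemma path_avoid v u p :
  path (avoid v) u p -> path (@Defs.arc R T) u p /\ v \notin p.
Proof.
elim: p u => //= a p IH u /andP[/and3P[ua _ av] /IH[-> vp]].
by rewrite ua inE negb_or vp eq_sym av.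
Qed.

Lemma branch_neq u v z : arc u v -> branch u v z -> z != v.
Proof.
move=> uv /connectP[p /path_avoid[_ vp] ->].
case: p vp => [|a p] vp; first exact: arc_neq.
by apply: contraNneq vp => <-; rewrite /= mem_last.
Qed.

(** A second edge from the branch to [v] would close a cycle. *)
Lemma branch_attach u v z : arc u v -> branch u v z -> arc z v -> z = u.
Proof.
move=> uv /connectP[p up ->] {z}; case/shortenP: up => {}p up uniq_up _ zv.
case: p up uniq_up zv => // a p up uniq_up zv.
have [{}up vp] := path_avoid up.
have uniq_c : uniq (v :: u :: a :: p).
  by rewrite cons_uniq uniq_up inE negb_or vp eq_sym arc_neq.
have cycle_c : cycle (@Defs.arc R T) (v :: u :: a :: p).
  by rewrite /= rcons_path zv arc_sym uv andbT.
by have := @tree_acyclic R T [:: v, u, a & p] isT uniq_c; rewrite cycle_c.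
Qed.

Lemma branch_closed u v a b :
  arc u v -> without (@Defs.arc R T) u v a b -> branch u v a = branch u v b.
Proof.
move=> uv.
have H c d : without (@Defs.arc R T) u v c d -> branch u v c -> branch u v d.
  move=> /and3P[cd cuv _] uc; apply: (connect_trans uc); apply: connect1.
  rewrite /avoid cd (branch_neq uv uc) /=; apply: contraNneq cuv => dv.
  by rewrite dv in cd *; rewrite (branch_attach uv uc cd).
move=> ab; apply/idP/idP; first exact: H.
apply: H; move: ab => /and3P[ab nuv nvu]; rewrite /without arc_sym ab /=.
by rewrite !xpair_eqE ![_ && (a == _)]andbC -!xpair_eqE nuv nvu.
Qed.

Lemma branch_not_parent u v : arc u v -> ~~ branch u v v.
Proof. by move=> uv; apply/negP => /(branch_neq uv)/eqP. Qed.

Section Conductance.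

Variable q : R.
Hypothesis q_gt0 : 0 < q.

Definition branch_cond u v : R :=
  conductance (@weight R T) q (without (@Defs.arc R T) u v) u.

Lemma branch_cond_ge u v : q <= branch_cond u v.
Proof.
by apply: conductance_ge => // a b /and3P[ab _ _]; exact: weight_ge0.
Qed.

Lemma branch_cond_gt0 u v : 0 < branch_cond u v.
Proof. exact: lt_le_trans (branch_cond_ge u v). Qed.

(** The tree in which the only edges left at [v] are those to [L]. It serves to
    attach the branches at [v] one at a time. *)
Definition star v (L : seq T) : rel T :=
  fun a b => [&& arc a b, (a == v) ==> (b \in L) & (b == v) ==> (a \in L)].

Lemma star_without v u L : arc v u -> u \notin L ->
  without (star v (u :: L)) v u = star v L.
Proof.
move=> vu uL; apply/funext => a; apply/funext => b.
rewrite /without /star !inE !xpair_eqE.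
have [ab|//] := boolP (arc a b); have := arc_neq ab => {ab}.
have uv := negbTE (arc_neq vu).
case: (a =P v) => [->|_]; case: (b =P v) => [->|_]; rewrite ?eqxx //= => _.
- rewrite uv andbF !andbT.
  by case: (b =P u) => [->|_]; rewrite ?(negbTE uL) ?andbT.
- by case: (a =P u) => [->|_] /=; rewrite ?(negbTE uL) ?andbT.
- by rewrite andbF.
Qed.

(** Each step attaches one more branch. The conductance of the new neighbour [u]
    is the one it has in its own branch, because that branch is a component both
    of the star and of the tree without the edge from [u] to [v]. *)
Lemma conductance_star v L : uniq L -> {subset L <= @Defs.arc R T v} ->
  conductance (@weight R T) q (star v L) v =
  q + \sum_(u <- L) in_series (weight v u) (branch_cond u v).
Proof.
elim: L => [|u L IH] uniqL Lv.
  rewrite big_nil addr0; apply: conductance_isolated => // [a b|u].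
    by move=> /and3P[ab _ _]; exact: weight_ge0.
  by rewrite /star eqxx andbF.
have /andP[uL uniqL'] := uniqL.
have vu : arc v u by apply: Lv; rewrite inE eqxx.
have uv : arc u v by rewrite arc_sym.
have w0 a b : star v (u :: L) a b -> 0 <= weight a b.
  by move=> /and3P[ab _ _]; exact: weight_ge0.
have sub a b : star v L a b -> without (@Defs.arc R T) u v a b.
  rewrite -(star_without vu uL) withoutC /without.
  by case/and3P=> /and3P[-> _ _] -> ->.
have branch_eq : conductance (@weight R T) q (star v L) u = branch_cond u v.
  apply: (@conductance_local _ _ _ _ (branch u v)) => //.
  - by move=> a b /and3P[ab _ _]; exact: weight_ge0.
  - by move=> a b /and3P[ab _ _]; exact: weight_ge0.
  - split=> [a b /sub|a b|a b ua ub]; try exact: branch_closed.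
    apply/idP/idP; first exact: sub.
    case/and3P=> ab _ _; rewrite /star ab.
    by rewrite (negbTE (branch_neq uv ua)) (negbTE (branch_neq uv ub)).
  - exact: connect0.
rewrite big_cons addrCA -IH //; last first.
  by move=> a aL; apply: Lv; rewrite inE aL orbT.
rewrite addrC -branch_eq -(star_without vu uL).
apply: (@conductance_add_edge _ _ _ _ _ _ _ (predC (branch u v))) => //.
- by rewrite /star vu (negbTE (arc_neq uv)) mem_head implybT.
- by rewrite /star uv (negbTE (arc_neq uv)) mem_head implybT.
- exact: arc_neq.
- exact: weight_sym.
- by rewrite star_without // => a b /sub ab /=; rewrite (branch_closed uv ab).
- exact: branch_not_parent.
- by rewrite /= negbK; exact: connect0.
Qed.

End Conductance.
End TreeRecursion.

(** * The random forest of a tree *)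

Section ForestsAsOutMaps.

Variables (R : realType) (T : wtree R) (q : R).
Hypothesis q_gt0 : 0 < q.
Local Notation arc := Defs.arc.
Notation outmap := {ffun T -> option T}.
Implicit Types (u v x y : T) (f : outmap) (F : {set T * T}).

Lemma without_star v p :
  without (@Defs.arc R T) v p = star v (enum [pred u | arc v u && (u != p)]).
Proof.
apply/funext => a; apply/funext => b; rewrite /without /star !mem_enum !inE.
rewrite !xpair_eqE; have [ab|//] := boolP (arc a b); have ba := ab.
rewrite arc_sym in ba.
case: (a =P v) => av; case: (b =P v) => bv; subst;
  rewrite ?ab ?ba ?andbT ?andbF //=.
- by rewrite andbT.
Qed.

Lemma branch_cond_rec v p : arc v p ->
  branch_cond q v p =
  q + \sum_(u | arc v u && (u != p)) in_series (weight v u) (branch_cond q u v).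
Proof.
move=> vp; rewrite {1}/branch_cond without_star.
rewrite conductance_star // ?enum_uniq //.
  by rewrite big_enum.
by move=> u; rewrite mem_enum inE => /andP[].
Qed.

Definition forest_of f : {set T * T} := [set e | f e.1 == Some e.2].

Definition outmap_of F : outmap := [ffun u => [pick v | (u, v) \in F]].

Lemma forest_ofK : cancel forest_of outmap_of.
Proof.
move=> f; apply/ffunP => u; rewrite ffunE; case: pickP => [v|fu].
  by rewrite inE => /eqP.
by case fv: (f u) => [v|//]; have := fu v; rewrite inE fv eqxx.
Qed.

Lemma outmap_ofK F : rooted_forest F -> forest_of (outmap_of F) = F.
Proof.
case=> _ Ffun _; apply/finset.setP => -[u v]; rewrite inE ffunE /=.
case: pickP => [z uz|uF]; last by rewrite uF.
by apply/eqP/idP => [[<-]//|uv]; rewrite (Ffun _ _ _ uz uv).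
Qed.

(** A shortest directed cycle has length two: longer ones would be cycles of the
    underlying tree. *)
Lemma rooted_forestP f :
  `[< rooted_forest (forest_of f) >] = admissible (@Defs.arc R T) f.
Proof.
apply/asboolP/idP => [[Farc _ Fcycle]|/admissibleP Sf].
  apply/admissibleP => u v fu; split; first by apply: Farc; rewrite inE fu.
  move=> fv; have /negP[] := Fcycle [:: u; v] isT.
  by rewrite /= !inE fu fv !eqxx.
split=> [u v|u v z|c]; rewrite ?inE /=.
- by move=> /eqP/Sf[].
- by move=> /eqP-> /eqP[].
case: c => // u c _; apply/negP => /= uc.
pose e : rel T := fun a b => (a, b) \in forest_of f.
have eS a b : e a b -> arc a b /\ ~ e b a.
  by rewrite /e !inE /= => /eqP/Sf[? ?]; split => // /eqP.
case E : (rcons c u) uc => [|v c'] /=; first by case: c E.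
case/andP=> uv vc; have lastu : last v c' = u.
  by have := last_rcons u c u; rewrite E.
move: lastu; case/shortenP: vc => p vp uniq_p _ lastu.
have [uv_arc not_vu] := eS _ _ uv.
case: p => [|z [|z' p]] in vp uniq_p lastu.
- by rewrite -lastu arc_irrefl in uv_arc.
- by move: vp; rewrite /= -/(e v z) andbT => vz; apply: not_vu; rewrite -lastu.
have /negP[] := @tree_acyclic R T [:: v, z, z' & p] isT uniq_p.
rewrite /cycle rcons_path lastu uv_arc andbT.
by apply: sub_path vp => a b /eS[].
Qed.

Lemma forest_weight_of f :
  forest_weight q (forest_of f) = outmap_weight (@weight R T) q f.
Proof.
rewrite /forest_weight /outmap_weight [RHS](bigID (fun u => f u == None)) /=.
congr (_ * _).
  rewrite (eq_bigr (fun=> q)) => [|u /eqP->//]; rewrite prodr_const /nroots.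
  congr (_ ^+ _); apply: eq_card => u; rewrite inE -[RHS]/(f u == None).
  apply/forallP/eqP => [fu|fu v]; last by rewrite inE /= fu.
  by case fv: (f u) => [v|//]; have := fu v; rewrite inE fv eqxx.
rewrite (reindex_onto (fun u => (u, odflt u (f u))) fst) /=.
  apply: eq_big => [u|u]; rewrite inE /= eqxx andbT; case: (f u) => //= v.
  by rewrite eqxx.
by move=> [u v]; rewrite inE /= => /eqP->.
Qed.

Lemma sum_forests (P : pred {set T * T}) :
  \sum_(F : {set T * T} | `[< rooted_forest F >] && P F) forest_weight q F =
  forest_sum (@weight R T) q (@Defs.arc R T) (fun f => P (forest_of f)).
Proof.
rewrite (reindex_onto forest_of outmap_of); last first.
  by move=> F /andP[/asboolP/outmap_ofK].
apply: eq_big => [f|f _]; last exact: forest_weight_of.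
by rewrite forest_ofK eqxx andbT rooted_forestP.
Qed.

(** A forest which avoids the edge between [x] and [y] cannot leave the branch
    at [x]. *)
Lemma same_tree_edge f x y : admissible (@Defs.arc R T) f -> arc x y ->
  same_tree (forest_of f) x y = (f x == Some y) || (f y == Some x).
Proof.
move=> /admissibleP Sf xy; apply/idP/idP => [|fxy]; last first.
  by apply: connect1; rewrite !inE.
apply: contraLR; rewrite negb_or => /andP[fx fy].
apply: contra (branch_not_parent xy) => xy_tree.
have H a b : ((a, b) \in forest_of f) || ((b, a) \in forest_of f) ->
    without (@Defs.arc R T) x y a b.
  rewrite !inE /= /without !xpair_eqE => fab.
  apply/and3P; split.
  - by case/orP: fab => /eqP/Sf[]; rewrite // arc_sym.
  - apply: contraL fab => /andP[/eqP-> /eqP->].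
    by rewrite (negbTE fx) (negbTE fy).
  - apply: contraL fab => /andP[/eqP-> /eqP->].
    by rewrite (negbTE fx) (negbTE fy).
have [p xp yp] := connectP xy_tree; rewrite [X in branch _ _ X]yp.
have stay z c : path (fun u v => ((u, v) \in forest_of f) ||
    ((v, u) \in forest_of f)) z c -> branch x y z -> branch x y (last z c).
  elim: c z => //= a c IH z /andP[/H za zc] xz; apply: IH => //.
  by rewrite -(branch_closed xy za).
exact: (stay _ _ xp (connect0 _ _)).
Qed.

Lemma U_edge x y : arc x y ->
  U q x y =
  (1 + weight x y / branch_cond q x y + weight x y / branch_cond q y x)^-1.
Proof.
move=> xy; have yx : arc y x by rewrite arc_sym.
set e := without (@Defs.arc R T) x y.
have w0 a b : e a b -> 0 <= weight a b by case/and3P=> /weight_ge0.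
have Ze : 0 < forest_sum (@weight R T) q e predT by exact: forest_sum_gt0.
have UE : U q x y = forest_sum (@weight R T) q e predT /
                    forest_sum (@weight R T) q (@Defs.arc R T) predT.
  have <- : partition_function T q =
            forest_sum (@weight R T) q (@Defs.arc R T) predT.
    rewrite -(sum_forests predT); apply: eq_bigl => F.
    by rewrite andbT.
  rewrite /U /forest_law -mulr_suml sum_forests; congr (_ / _).
  rewrite forest_sum_without.
  apply: eq_forest_sum => f Sf; rewrite same_tree_edge //= negb_or.
  by rewrite andbT andbC.
have ZE := @forest_sum_add_edge _ _ (@weight R T) q (@Defs.arc R T) x y
  q_gt0 xy yx (arc_neq xy) (weight_sym xy).
rewrite UE ZE /branch_cond (withoutC _ y x) -/e /conductance.
have Zx : 0 < forest_sum (@weight R T) q e (rooted_at x).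
  exact: forest_sum_rooted_gt0.
have Zy : 0 < forest_sum (@weight R T) q e (rooted_at y).
  exact: forest_sum_rooted_gt0.
rewrite -[LHS]invrK invf_div; congr (_^-1).
by field; rewrite !gt_eqF.
Qed.

End ForestsAsOutMaps.

(** * Distances and heights *)

Section Distance.

Lemma bigminn_leP (I : finType) (P : pred I) (F : I -> nat) m n :
  reflect ((m <= n)%N \/ exists2 i, P i & (F i <= n)%N)
          (\big[minn/m]_(i | P i) F i <= n)%N.
Proof. exact: (@bigmin_leP _ nat m I P n F). Qed.

Variables (R : realType) (G : wdigraph R).
Local Notation arc := (@Defs.arc R G).
Implicit Types x y : G.

Lemma graph_dist_le x y p : path arc x p -> last x p = y ->
  (graph_dist x y <= size p)%N.
Proof.
move=> xp yp; apply/bigminn_leP; move: yp.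
case/shortenP: (xp) => c xc uniq_c sub_c yc.
have szc : (size c < #|G|)%N.
  by rewrite -[(size c).+1]/(size (x :: c)) -(card_uniqP uniq_c) max_card.
right; exists (Ordinal szc).
  by apply/existsP; exists (in_tuple c); rewrite /= xc yc eqxx.
by apply: uniq_leq_size => //; have /andP[] := uniq_c.
Qed.

Lemma graph_dist_path x y : connect arc x y ->
  exists p, [/\ path arc x p, last x p = y & size p = graph_dist x y].
Proof.
move=> /connectP[p xp yp].
have ltG : (graph_dist x y < #|G|)%N.
  move: yp; case/shortenP: xp => c xc uniq_c _ yc.
  apply: leq_ltn_trans (graph_dist_le xc (esym yc)) _.
  by rewrite -[(size c).+1]/(size (x :: c)) -(card_uniqP uniq_c) max_card.
have /bigminn_leP[|[n /existsP[c /andP[xc /eqP yc]] len]] :=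
  leqnn (graph_dist x y).
  by rewrite leqNgt ltG.
exists c; split=> //; apply/eqP; rewrite eqn_leq graph_dist_le // andbT.
by rewrite size_tuple.
Qed.

End Distance.

Section Heights.

Variables (R : realType) (T : wtree R).
Local Notation arc := (@Defs.arc R T).
Implicit Types u v x y z : T.

Lemma graph_dist_arc u v z :
  arc u v -> (graph_dist u z <= (graph_dist v z).+1)%N.
Proof.
move=> uv; have [p [vp lp <-]] := graph_dist_path (tree_connected v z).
by apply: (@graph_dist_le _ _ _ _ (v :: p)); rewrite /= ?uv.
Qed.

Lemma height_eq0 v : (height v == 0%N) = (v == ancestor T).
Proof.
apply/eqP/eqP => [v0|->]; last first.
  by apply/eqP; rewrite -leqn0; exact: (@graph_dist_le _ _ _ _ [::]).
have [p [_ lp sz]] := graph_dist_path (tree_connected v (ancestor T)).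
by move: sz lp; rewrite -/(height v) v0; case: p.
Qed.

Lemma parent_exists v : v != ancestor T ->
  exists2 u, arc v u & height v = (height u).+1.
Proof.
move=> va.
have [p [vp lp sz]] := graph_dist_path (tree_connected v (ancestor T)).
case: p vp lp sz => [|u p] /=; first by move=> _ E; rewrite E eqxx in va.
move=> /andP[vu up] lp sz; exists u => //; apply/eqP; rewrite eqn_leq.
by rewrite graph_dist_arc //= /height -sz ltnS (graph_dist_le up lp).
Qed.

Lemma connect_ancestor_avoid v z : v != ancestor T ->
  (height z <= height v)%N -> z != v -> connect (avoid v) z (ancestor T).
Proof.
move=> va; have [n zn] : exists n, height z = n by exists (height z).
elim: n z zn => [|n IH] z zn zv neq_zv.
  by move/eqP: zn; rewrite height_eq0 => /eqP->.
have za : z != ancestor T by rewrite -height_eq0 zn.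
have [u zu hz] := parent_exists za.
have hu : height u = n by apply/eqP; rewrite -eqSS -hz zn.
have uv : u != v.
  by apply: contraTneq zv => <-; rewrite -ltnNge zn hu.
apply: (connect_trans (connect1 _)) (IH u hu _ uv).
  by rewrite /avoid zu neq_zv uv.
by rewrite hu; apply: leq_trans zv; rewrite zn.
Qed.

(** From a neighbour of [v] that is not higher than [v], a geodesic leads to the
    ancestor while avoiding [v]; so two such neighbours are in the same branch
    at [v], which is attached by a single edge. *)
Lemma lower_neighbour_unique v u u' : arc v u -> arc v u' ->
  (height u <= height v)%N -> (height u' <= height v)%N -> u = u'.
Proof.
move=> vu vu' hu hu'; have uv : arc u v by rewrite arc_sym.
have u'v : arc u' v by rewrite arc_sym.
have va : v != ancestor T.
  apply: contraTneq (vu) => va; move: hu.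
  have /eqP-> : height v == 0%N by rewrite height_eq0 va.
  by rewrite leqn0 height_eq0 -va => /eqP->; rewrite arc_irrefl.
apply/esym; apply: (branch_attach uv _ u'v).
apply: connect_trans (connect_ancestor_avoid va hu (arc_neq uv)) _.
rewrite (sym_connect_sym (@avoid_sym _ T v)).
exact: connect_ancestor_avoid va hu' (arc_neq u'v).
Qed.

End Heights.

(** * Conductances in regular trees *)

Section RegularTrees.

Variables (R : realType) (T : wtree R) (d : nat).
Local Notation arc := (@Defs.arc R T).
Implicit Types u v p x y : T.
Hypotheses (d_gt0 : (0 < d)%N) (Tregular : regular T d).

Lemma neighbour_children p v u : is_parent p v ->
  arc v u && (u != p) = (u \in children v).
Proof.
rewrite inE /is_parent => /andP[pv /eqP hv].
have [vu|//] /= := boolP (arc v u).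
have vp : arc v p by rewrite arc_sym.
apply/idP/eqP => [|hu]; last first.
  by apply: contra_eq_neq hu => ->; rewrite hv ltn_eqF.
move=> up; apply/eqP; rewrite eqn_leq graph_dist_arc 1?arc_sym //= ltnNge.
apply: contra up => hu; apply/eqP; apply: lower_neighbour_unique vu vp hu _.
by rewrite hv.
Qed.

Lemma height_le_tree_height v : (height v <= tree_height T)%N.
Proof. exact: leq_bigmax. Qed.

Lemma card_children v :
  #|children v| = if (height v < tree_height T)%N then d else 0%N.
Proof.
case: ltnP => [/Tregular//|hv]; apply/eqP; rewrite cards_eq0.
apply/eqP/finset.setP => u; rewrite !inE; apply/negP => /andP[_ /eqP hu].
by have := height_le_tree_height u; rewrite hu ltnNge hv.
Qed.

Lemma is_leafE v : is_leaf v = (height v == tree_height T).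
Proof.
rewrite /is_leaf -cards_eq0 card_children [RHS]eqn_leq height_le_tree_height /=.
by case: ltnP => // _; rewrite eqn0Ngt d_gt0.
Qed.

Lemma height_last x c :
  path arc x c -> (height (last x c) <= height x + size c)%N.
Proof.
elim: c x => [|u c IH] x /=; first by rewrite addn0.
move=> /andP[xu /IH{}IH]; apply: leq_trans IH _; rewrite addnS -addSn leq_add2r.
by apply: graph_dist_arc; rewrite arc_sym.
Qed.

Lemma leaf_descendant v : exists2 l, is_leaf l &
  (graph_dist v l <= tree_height T - height v)%N.
Proof.
have [m hm] : exists m, (tree_height T - height v)%N = m by eexists.
elim: m v hm => [|m IH] v hm.
  exists v; last by rewrite hm; exact: (@graph_dist_le _ _ _ _ [::]).
  by rewrite is_leafE eqn_leq height_le_tree_height -subn_eq0 hm.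
have /card_gt0P[u] : (0 < #|children v|)%N.
  by rewrite Tregular // -subn_gt0 hm.
rewrite inE => /andP[vu /eqP hu].
have [|l leaf_l dl] := IH u; first by rewrite hu subnS hm.
exists l => //; apply: leq_trans (graph_dist_arc _ vu) _.
by rewrite hm ltnS (leq_trans dl) // hu subnS hm.
Qed.

(** All leaves are at maximal height, a path from [y] gains at most one unit of
    height per step, and descending gains exactly one. *)
Lemma height_leaf_dist y : (height y + leaf_dist y)%N = tree_height T.
Proof.
apply/eqP; rewrite eqn_leq; apply/andP; split.
  rewrite -leq_subRL ?height_le_tree_height //; apply/bigminn_leP; right.
  exact: leaf_descendant.
have /bigminn_leP[big|[l leaf_l dl]] := leqnn (leaf_dist y).
  apply: leq_trans (leq_trans big (leq_addl _ _)).
  by apply/bigmax_leqP => v _; apply/bigminn_leP; left.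
have [c [yc lc sc]] := graph_dist_path (tree_connected y l).
move: leaf_l; rewrite is_leafE => /eqP <-; rewrite -lc.
by apply: leq_trans (height_last yc) _; rewrite leq_add2l sc.
Qed.

Variable q : R.
Hypothesis q_gt0 : 0 < q.

Lemma branch_cond_children p v : is_parent p v ->
  branch_cond q v p =
  q + \sum_(u in children v) in_series (weight v u) (branch_cond q u v).
Proof.
move=> pv; rewrite branch_cond_rec //; last first.
  by have /andP[] := pv; rewrite arc_sym.
by congr (_ + _); apply: eq_bigl => u; exact: neighbour_children.
Qed.

Lemma weight_child_ge0 v u : u \in children v -> 0 <= weight v u.
Proof. by rewrite inE => /andP[/weight_ge0]. Qed.

(** Dropping the weights of the edges bounds the conductance by [q] times the
    number 1 + d + ... + d^j of vertices of the subtree of [v], and each of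
    these [j.+1] powers is at most d^j. *)
Lemma branch_cond_le j v p :
  is_parent p v -> (height v + j)%N = tree_height T ->
  branch_cond q v p <= j.+1%:R * d%:R ^+ j * q.
Proof.
elim: j v p => [|j IH] v p pv hv; rewrite branch_cond_children //.
  rewrite big_pred0 ?addr0 ?expr0 ?mulr1 ?mul1r // => u.
  have /eqP := card_children v; rewrite -hv addn0 ltnn cards_eq0.
  by move=> /eqP ->; rewrite inE.
have d1 : 1 <= d%:R :> R by rewrite ler1n.
have : \sum_(u in children v) in_series (weight v u) (branch_cond q u v) <=
    \sum_(u in children v) j.+1%:R * d%:R ^+ j * q.
  apply: ler_sum => u vu.
  have cu := branch_cond_gt0 q_gt0 u v.
  apply: le_trans (in_series_le (weight_child_ge0 vu) cu) _.
  move: vu; rewrite inE => vu; apply: IH => //.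
  by have /andP[_ /eqP->] := vu; rewrite addSnnS.
rewrite sumr_const card_children -hv addnS ltnS leq_addr -[_ *+ d]mulr_natr.
have : q <= d%:R ^+ j.+1 * q by rewrite ler_peMl ?exprn_ege1 // ltW.
rewrite -[j.+2%:R]natr1 exprS => q_le sum_le.
apply: le_trans (lerD q_le sum_le) _; rewrite le_eqVlt; apply/orP; left.
by apply/eqP; ring.
Qed.

(** This is a lower bound by the minimum of [d * W] and [d ^ j * q], up to a
    constant, in terms of any lower bound [m] of the two. Each child contributes
    at least half the minimum of [W] and of its own conductance, and one
    generation down the induction applies to [m / d], which is at most [W]. *)
Lemma branch_cond_ge_min (W m : R) j v p : is_parent p v ->
  (height v + j)%N = tree_height T ->
  (forall a b : T, is_parent a b -> (height v <= height a)%N ->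
     W <= weight a b) ->
  0 <= W -> 0 <= m -> m <= d%:R * W -> m <= d%:R ^+ j * q ->
  m / 2 ^+ j <= branch_cond q v p.
Proof.
move=> + + + W0.
have d1 : 1 <= d%:R :> R by rewrite ler1n.
have d0 : 0 < d%:R :> R by rewrite ltr0n.
elim: j v p m => [|j IH] v p m pv hv HW m0 mW mq.
  rewrite expr0 divr1; apply: le_trans mq _; rewrite expr0 mul1r.
  exact: branch_cond_ge.
rewrite branch_cond_children //.
pose m' := m / d%:R.
have mE : m = d%:R * m' by rewrite /m' mulrC divfK // gt_eqF.
have m'0 : 0 <= m' by rewrite divr_ge0 // ltW.
have m'W : m' <= W by rewrite /m' ler_pdivrMr // mulrC.
have m'q : m' <= d%:R ^+ j * q.
  by rewrite /m' ler_pdivrMr // mulrAC -exprSr.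
have p2 : 1 <= 2 ^+ j :> R by rewrite exprn_ege1 // ler1n.
have : \sum_(u in children v) m' / 2 ^+ j / 2 <=
    \sum_(u in children v) in_series (weight v u) (branch_cond q u v).
  apply: ler_sum => u vu; have w0 := weight_child_ge0 vu.
  move: vu; rewrite inE => vu; have /andP[_ /eqP hu] := vu.
  apply: in_series_ge => //; last exact: branch_cond_gt0.
    apply: le_trans (HW _ _ vu (leqnn _)); apply: le_trans m'W.
    by rewrite ler_pdivrMr ?ler_peMr // (lt_le_trans ltr01).
  apply: IH => //; first by rewrite hu addSnnS.
    move=> a b ab; rewrite hu => /ltnW; exact: HW.
  by apply: le_trans m'W _; rewrite ler_peMl.
rewrite sumr_const card_children -hv addnS ltnS leq_addr -[_ *+ d]mulr_natr.
move=> le_sum; apply: le_trans (le_trans le_sum _); last by rewrite lerDr ltW.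
by rewrite mE exprSr invfM le_eqVlt; apply/orP; left; apply/eqP; ring.
Qed.

End RegularTrees.

(** * Bounds for one edge *)

Section EdgeBounds.

Variables (R : realType) (T : wtree R) (d k : nat) (x y : T) (q : R).
Hypotheses (Tregular : regular T d) (Thier : hierarchical T).
Hypotheses (xy : is_parent x y) (yk : leaf_dist y = k) (q_gt0 : 0 < q).

Let W := weight x y.

Lemma degree_gt0 : (0 < d)%N.
Proof.
have yx : y \in children x by rewrite inE.
have := card_children Tregular x; rewrite (cardD1 y) yx.
by case: ltnP => // _ <-.
Qed.

Lemma edge_weight_ge0 : 0 <= W.
Proof. by apply: weight_ge0; have /andP[] := xy. Qed.

Lemma height_child : (height y + k)%N = tree_height T.
Proof. by rewrite -yk; exact: height_leaf_dist degree_gt0 Tregular y. Qed.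

Lemma edge_weight_le (a b : T) :
  is_parent a b -> (height x <= height a)%N -> W <= weight a b.
Proof.
move=> ab xa; have [eq_gen lt_gen] := Thier.
have gen_xy : in_generation (height y) x y by rewrite /in_generation xy eqxx.
have gen_ab : in_generation (height b) a b by rewrite /in_generation ab eqxx.
have /andP[_ /eqP hy] := xy; have /andP[_ /eqP hb] := ab.
move: xa; rewrite -ltnS -hy -hb leq_eqVlt => /orP[/eqP E|lt].
  by rewrite /W (eq_gen (height b) x y a b) // -E.
exact: lt_gen lt gen_xy gen_ab.
Qed.

Lemma child_conductance_le : branch_cond q y x <= k.+1%:R * d%:R ^+ k * q.
Proof.
exact: (branch_cond_le degree_gt0 Tregular q_gt0 xy height_child).
Qed.

Lemma child_conductance_ge m : 0 <= m -> m <= d%:R * W -> m <= d%:R ^+ k * q ->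
  m / 2 ^+ k <= branch_cond q y x.
Proof.
move=> m0 mW mq; have W0 := edge_weight_ge0.
apply: (branch_cond_ge_min degree_gt0 Tregular q_gt0 xy height_child)
  m0 mW mq => // a b ab ya.
apply: edge_weight_le ab (leq_trans _ ya).
by have /andP[_ /eqP->] := xy.
Qed.

(** The [d - 1] siblings of [y] carry branches of the same shape as the branch
    at [y]. Their number is at least [d / 2] unless [d = 1]; in that case [q]
    alone is at least [m]. *)
Lemma parent_conductance_ge m : 0 <= m -> m <= d%:R * W -> m <= d%:R ^+ k * q ->
  m / 2 ^+ k.+2 <= branch_cond q x y.
Proof.
move=> m0 mW mq.
have d0 : 0 < d%:R :> R by rewrite ltr0n degree_gt0.
have d1 : 1 <= d%:R :> R by rewrite ler1n degree_gt0.
have [xy_arc /eqP hy] := andP xy; have W0 := edge_weight_ge0.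
pose m' := m / d%:R.
have mE : m = d%:R * m' by rewrite /m' mulrC divfK // gt_eqF.
have m'0 : 0 <= m' by rewrite divr_ge0 // ltW.
have m'W : m' <= W by rewrite /m' ler_pdivrMr // mulrC.
have m'm : m' <= m by rewrite mE ler_peMl.
pose t := m' / 2 ^+ k.
have p1 : 1 <= 2 ^+ k :> R by rewrite exprn_ege1 // ler1n.
have p0 : 0 < 2 ^+ k :> R by rewrite exprn_gt0.
have t0 : 0 <= t by rewrite divr_ge0 // ltW.
have siblings : q + \sum_(u in children x :\ y) t / 2 <= branch_cond q x y.
  rewrite branch_cond_rec //; apply: lerD => //.
  (* The remaining neighbour, the parent of x if any, contributes at least 0. *)
  rewrite [leRHS](bigID (mem (children x))) /= -[leLHS]addr0; apply: lerD.
    rewrite [leRHS](eq_bigl (mem (children x :\ y))); last first.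
      move=> u; rewrite /= !inE /is_parent.
      by case: (Defs.arc x u); rewrite ?andbF.
    apply: ler_sum => u; rewrite !inE => /andP[_ xu].
    have [xu_arc /eqP hu] := andP xu.
    have xa := edge_weight_le xu (leqnn _).
    apply: in_series_ge; last exact: branch_cond_gt0.
    - apply: le_trans xa; apply: le_trans m'W.
      by rewrite ler_pdivrMr // ler_peMr.
    - apply: (branch_cond_ge_min (W := W) degree_gt0 Tregular q_gt0 xu)
        (le_trans m'm mq) => //.
      + by rewrite hu -hy height_child.
      + move=> a b ab; rewrite hu => /ltnW; exact: edge_weight_le ab.
      + by apply: le_trans m'W _; rewrite ler_peMl.
    - exact: weight_ge0.
  apply: sumr_ge0 => u /andP[/andP[xu _] _].
  by apply: in_series_ge0; [exact: weight_ge0 | exact: branch_cond_gt0].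
have yx : y \in children x by rewrite inE.
have card_siblings : (#|children x :\ y|.+1)%N = d.
  have := card_children Tregular x; rewrite (cardsD1 y) yx => E.
  by move: E; case: ltnP => // _ <-.
apply: le_trans siblings; rewrite sumr_const -[_ *+ #|_|]mulr_natr.
have -> : m / 2 ^+ k.+2 = d%:R * (t / 4).
  by rewrite mE /t !exprS !invfM; field; rewrite gt_eqF.
have tm' : t <= m' by rewrite ler_pdivrMr // ler_peMr.
rewrite -[in leLHS]card_siblings -natr1.
case E : #|children x :\ y| => [|n].
  have d1' : d = 1%N by rewrite -card_siblings E.
  move: mq; rewrite d1' expr1n => mq; lra.
have nt : 0 <= n%:R * t by rewrite mulr_ge0.
by rewrite -[n.+1%:R]natr1; clearbody t; move: q_gt0; nra.
Qed.

Lemma U_le1 : U q x y <= 1.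
Proof.
have [xy_arc _] := andP xy; rewrite U_edge // -/W.
have W0 := edge_weight_ge0; have cx := branch_cond_gt0 q_gt0 x y.
have cy := branch_cond_gt0 q_gt0 y x.
have sx : 0 <= W / branch_cond q x y by rewrite divr_ge0 // ltW.
have sy : 0 <= W / branch_cond q y x by rewrite divr_ge0 // ltW.
by rewrite invf_le1; lra.
Qed.

Lemma U_ge0 : 0 <= U q x y.
Proof.
have [xy_arc _] := andP xy; rewrite U_edge //.
have W0 := edge_weight_ge0; have cx := branch_cond_gt0 q_gt0 x y.
have cy := branch_cond_gt0 q_gt0 y x.
by rewrite invr_ge0 !addr_ge0 // divr_ge0 // ltW.
Qed.

Lemma U_le e : q <= e * (d%:R ^- k * W) -> U q x y <= k.+1%:R * e.
Proof.
move=> qe; have [xy_arc _] := andP xy; rewrite U_edge // -/W.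
have cx := branch_cond_gt0 q_gt0 x y.
have cy := branch_cond_gt0 q_gt0 y x.
have dk : 0 < d%:R ^+ k :> R by rewrite exprn_gt0 // ltr0n degree_gt0.
have W0 : 0 < W.
  rewrite lt_neqAle edge_weight_ge0 andbT; apply: contraTneq qe => <-.
  by rewrite !mulr0 -ltNge.
have cyW : branch_cond q y x <= k.+1%:R * e * W.
  apply: le_trans child_conductance_le _; rewrite -!mulrA ler_wpM2l //.
  by rewrite -ler_pdivlMl // mulrCA.
have WV : 0 < W / branch_cond q y x by rewrite divr_gt0.
have Wx : 0 <= W / branch_cond q x y by rewrite divr_ge0 // ltW.
apply: le_trans (_ : (W / branch_cond q y x)^-1 <= _).
  by rewrite lef_pV2 ?posrE //; lra.
by rewrite invf_div ler_pdivrMr.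
Qed.

(** The exponent [k.+1] leaves one factor [r] for the conclusion after [k] of
    them have been spent on comparing [d] with [1 / r]. *)
Lemma U_ge (r : R) : 0 < r -> r <= 1 -> d%:R ^- k * W <= r ^+ k.+1 * q ->
  1 - U q x y <= 2 ^+ k.+3 * r.
Proof.
move=> r0 r1 Wq; have [xy_arc _] := andP xy; rewrite U_edge // -/W.
have W0 := edge_weight_ge0.
have cx := branch_cond_gt0 q_gt0 x y.
have cy := branch_cond_gt0 q_gt0 y x.
have d0 : 0 < d%:R :> R by rewrite ltr0n degree_gt0.
have dk : 0 < d%:R ^+ k :> R by rewrite exprn_gt0.
have {}Wq : W <= r ^+ k.+1 * (d%:R ^+ k * q).
  by move: Wq; rewrite ler_pdivrMl // mulrCA.
have [Wx Wy] : W <= 2 ^+ k.+2 * r * branch_cond q x y /\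
               W <= 2 ^+ k.+2 * r * branch_cond q y x.
  have [dr|dr] := leP 1 (d%:R * r).
    (* Here d is large, and m = W / r is below both d W and d^k q. *)
    have m0 : 0 <= W / r by rewrite divr_ge0 // ltW.
    have mW : W / r <= d%:R * W.
      by rewrite ler_pdivrMr // mulrAC ler_peMl.
    have mq : W / r <= d%:R ^+ k * q.
      rewrite ler_pdivrMr //; apply: le_trans Wq _.
      rewrite exprS [leRHS]mulrC -mulrA ler_pM2l // ler_piMl //.
        by rewrite ltW // mulr_gt0.
      by rewrite exprn_ile1 // ltW.
    split.
      have := parent_conductance_ge m0 mW mq.
      rewrite ler_pdivrMr ?exprn_gt0 // ler_pdivrMr //.
      by rewrite -mulrA [branch_cond _ _ _ * _]mulrC.
    have := child_conductance_ge m0 mW mq.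
    rewrite ler_pdivrMr ?exprn_gt0 // ler_pdivrMr // => /le_trans; apply.
    have pos : 0 <= branch_cond q y x * 2 ^+ k * r.
      by rewrite ltW // mulr_gt0 // mulr_gt0.
    have -> : 2 ^+ k.+2 * r * branch_cond q y x =
              4 * (branch_cond q y x * 2 ^+ k * r).
      by rewrite !exprS; ring.
    by rewrite ler_peMl // ler1n.
  (* Here (d r)^k is at most 1, so that W is already small compared to q. *)
  have Wrq : W <= r * q.
    apply: le_trans Wq _; rewrite exprS -mulrA ler_pM2l // mulrA -exprMn.
    rewrite mulrC ler_piMr ?(ltW q_gt0) // mulrC.
    by rewrite exprn_ile1 // ?mulr_ge0 // ltW.
  have p4 : 1 <= 2 ^+ k.+2 :> R by rewrite exprn_ege1 // ler1n.
  split; apply: le_trans Wrq _; rewrite -mulrA [leRHS]mulrA;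
    by rewrite ler_pM ?ler_peMl ?branch_cond_ge // ltW.
have Wx' : W / branch_cond q x y <= 2 ^+ k.+2 * r by rewrite ler_pdivrMr.
have Wy' : W / branch_cond q y x <= 2 ^+ k.+2 * r by rewrite ler_pdivrMr.
have sx : 0 <= W / branch_cond q x y by rewrite divr_ge0 // ltW.
have sy : 0 <= W / branch_cond q y x by rewrite divr_ge0 // ltW.
rewrite exprS; move: Wx' Wy' sx sy.
set a := W / _; set b := W / _; set c := 2 ^+ _ * r => ha hb a0 b0.
have s0 : 0 < 1 + a + b by lra.
have : 1 - (1 + a + b)^-1 <= a + b.
  rewrite -subr_ge0.
  have -> : a + b - (1 - (1 + a + b)^-1) = (a + b) ^+ 2 / (1 + a + b).
    by field; rewrite gt_eqF.
  by rewrite divr_ge0 ?sqr_ge0 // ltW.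
by move=> /le_trans; apply; rewrite -mulrA -/c; lra.
Qed.

End EdgeBounds.

(** * The phase transition *)

Theorem theorem7 (R : realType) (G : nat -> wtree R) (d : nat -> nat) (k : nat)
    (x y : forall n : nat, G n) (q : nat -> R)
    (Gregular : forall n : nat, regular (G n) (d n))
    (Ghierarchical : forall n : nat, hierarchical (G n))
    (xy_parent : forall n : nat, is_parent (x n) (y n))
    (y_leaf_dist : forall n : nat, leaf_dist (y n) = k)
    (q_gt0 : forall n : nat, 0 < q n) :
  (q =o_\oo
     ((fun n : nat => (d n)%:R ^- k * weight (x n) (y n)) : nat -> R) ->
   (fun n : nat => U (q n) (x n) (y n)) @ \oo --> (0 : R)) /\
  (((fun n : nat => (d n)%:R ^- k * weight (x n) (y n)) : nat -> R)
     =o_\oo q ->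
   (fun n : nat => U (q n) (x n) (y n)) @ \oo --> (1 : R)).
Proof.
have scale_ge0 n : 0 <= (d n)%:R ^- k * weight (x n) (y n) :> R.
  by rewrite mulr_ge0 ?invr_ge0 ?exprn_ge0 // (edge_weight_ge0 (xy_parent n)).
split=> /eqoP small; apply/cvgrPdist_le => e e_gt0.
  have : 0 < e / k.+1%:R by rewrite divr_gt0.
  move=> /small; apply: filterS => n.
  rewrite gtr0_norm // ger0_norm // => qn.
  rewrite sub0r normrN ger0_norm; last exact: U_ge0.
  have := U_le (Gregular n) (xy_parent n) (y_leaf_dist n) (q_gt0 n) qn.
  by rewrite mulrCA divff ?mulr1.
pose r := Num.min 1 (e / 2 ^+ k.+3).
have r_gt0 : 0 < r by rewrite lt_min ltr01 divr_gt0 // exprn_gt0.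
have : 0 < r ^+ k.+1 by rewrite exprn_gt0.
move=> /small; apply: filterS => n.
rewrite (ger0_norm (scale_ge0 n)) (gtr0_norm (q_gt0 n)) => Wn.
have r_le1 : r <= 1 by rewrite ge_min lexx.
rewrite ger0_norm ?subr_ge0 ?(U_le1 (xy_parent n)) //.
apply: le_trans (U_ge (Gregular n) (Ghierarchical n) (xy_parent n)
  (y_leaf_dist n) (q_gt0 n) r_gt0 r_le1 Wn) _.
rewrite mulrC -ler_pdivlMr ?exprn_gt0 //.
by rewrite ge_min lexx orbT.
Qed.
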